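(* Let $\mathcal{T}$ be a background first-order theory, let $\varphi$ be a quantifier-free $\mathcal{T}$-formula, and let $\boldsymbol{\alpha}=\boldsymbol{\alpha}_1\cup\boldsymbol{\alpha}_2$ be a finite set of atoms containing all atoms occurring in $\varphi$, such that no atom in $\boldsymbol{\alpha}_1$ shares variables or uninterpreted symbols with any atom in $\boldsymbol{\alpha}_2$. Write each total truth assignment on $\boldsymbol{\alpha}$ as $\eta_1\wedge\eta_2$ with $\eta_1$ a total truth assignment on $\boldsymbol{\alpha}_1$ and $\eta_2$ a total truth assignment on $\boldsymbol{\alpha}_2$. Let $$BC_1(\varphi)=\{\neg\eta_1 \;:\; \eta_1\wedge\eta_2\in H_{\boldsymbol{\alpha}}(\varphi)\},$$ and let $Cl$ be a set of $\mathcal{T}$-lemmas such that $BC_1(\varphi)\cup Cl$ rules out $P_{\boldsymbol{\alpha}}(\varphi)$. Let $\varphi'=\varphi\wedge\bigwedge_{C\in Cl}C$ (considered as a formula on $\boldsymbol{\alpha}$). Let $$BC_2=\{\neg\eta_2 \;:\; \eta_1\wedge\eta_2\in H_{\boldsymbol{\alpha}}(\varphi')\},$$ and let $Cl'$ be a set of $\mathcal{T}$-lemmas such that $BC_2\cup Cl'$ rules out $P_{\boldsymbol{\alpha}}(\varphi')$. Then $Cl\cup Cl'$ rules out $P_{\boldsymbol{\alpha}}(\varphi)$.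
   Context: A $\mathcal{T}$-formula is a Boolean combination (via $\neg,\wedge,\vee,\to,\leftrightarrow$) of Boolean atoms (propositional variables) and $\mathcal{T}$-atoms (quantifier-free atomic formulas of the theory $\mathcal{T}$). A total truth assignment on a set of atoms $\boldsymbol{\alpha}$ is a conjunction containing exactly one literal (the atom or its negation) for each atom of $\boldsymbol{\alpha}$. The Boolean abstraction maps each Boolean atom to itself and each $\mathcal{T}$-atom to a fresh propositional variable (injectively), homomorphically w.r.t. Boolean connectives; a conjunction of literals $\eta$ propositionally satisfies $\varphi$, written $\eta\models_p\varphi$, if the Boolean abstraction of $\eta$ entails that of $\varphi$ in propositional logic; $\psi\equiv_{\mathcal{B}}\bot$ means the Boolean abstraction of $\psi$ is propositionally unsatisfiable. For a $\mathcal{T}$-formula $\psi$ whose atoms are in $\boldsymbol{\alpha}$, $H_{\boldsymbol{\alpha}}(\psi)$ denotes the set of total truth assignments $\eta$ on $\boldsymbol{\alpha}$ with $\eta\models_p\psi$ that are $\mathcal{T}$-satisfiable; $P_{\boldsymbol{\alpha}}(\psi)$ denotes the set of total truth assignments $\rho$ on $\boldsymbol{\alpha}$ with $\rho\models_p\psi$ that are $\mathcal{T}$-unsatisfiable. A $\mathcal{T}$-lemma is a $\mathcal{T}$-valid clause. A set of clauses $\{C_1,\dots,C_K\}$ rules out a set $\{\rho_1,\dots,\rho_M\}$ of total truth assignments iff for every $\rho_j$ there is some $C_l$ with $\rho_j\models_p\neg C_l$, i.e. iff $\bigvee_j\rho_j\wedge\bigwedge_l C_l\equiv_{\mathcal{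B}}\bot$.
   Formalization: The background theory T is additionally assumed to have the joint embedding property (any two models of T embed in a common model of T); for arbitrary T the claim fails, e.g. T = {(∀x p(x)) ∨ (∀x ¬p(x))}, α1 = {p(x)}, α2 = {p(y)}, φ = ⊤, Cl = Cl' = ∅. *)

(* Defs.v *)
From HB Require Import structures.
From mathcomp Require Import all_boot finmap.
From mathcomp Require Import boolp classical_sets.
Set Implicit Arguments.
Unset Strict Implicit.
Unset Printing Implicit Defensive.

Local Open Scope classical_set_scope.

Record signature := Signature {
  fsym : Type; far : fsym -> nat;
  psym : Type; par : psym -> nat }.

(* The theory speaks about [S]; the atoms of a formula live over [S] plus a
   disjoint signature [G] of uninterpreted symbols. *)
Definition sig_sum (S G : signature) : signature :=
  @Signature (fsym S + fsym G)
             (fun f => match f with inl f => far f | inr g => far g end)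
             (psym S + psym G)
             (fun p => match p with inl p => par p | inr q => par q end).

Inductive term (S : signature) :=
| Var of nat
| App (f : fsym S) of ('I_(far f) -> term S).

Inductive fo_atom (S : signature) :=
| EqAtom of term S & term S
| RelAtom (p : psym S) of ('I_(par p) -> term S).

(* Classically complete choice of connectives, used for the axioms of theories. *)
Inductive fo_formula (S : signature) :=
| FoAtom of fo_atom S
| FoFalse
| FoImp of fo_formula S & fo_formula S
| FoAll of nat & fo_formula S.
Arguments FoFalse {S}.

Record interp (S : signature) (D : Type) := Interp {
  ifun : forall f : fsym S, ('I_(far f) -> D) -> D;
  irel : forall p : psym S, ('I_(par p) -> D) -> Prop }.

Record structure (S : signature) := Structure {
  dom :> Type;
  dom_pt : dom; (* carriers are nonempty *)
  itp : interp S dom }.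

Definition interp_sum (S G : signature) (D : Type)
    (i : interp S D) (j : interp G D) : interp (sig_sum S G) D :=
  @Interp (sig_sum S G) D
    (fun f => match f return ('I_(@far (sig_sum S G) f) -> D) -> D with
              | inl f => ifun i (f := f) | inr g => ifun j (f := g) end)
    (fun p => match p return ('I_(@par (sig_sum S G) p) -> D) -> Prop with
              | inl p => irel i (p := p) | inr q => irel j (p := q) end).

Fixpoint teval (S : signature) (D : Type) (i : interp S D) (e : nat -> D)
    (t : term S) : D :=
  match t with
  | Var x => e x
  | App f ts => ifun i (fun k => teval i e (ts k))
  end.

Definition fo_atom_holds (S : signature) (D : Type) (i : interp S D)
    (e : nat -> D) (a : fo_atom S) : Prop :=
  match a with
  | EqAtom t u => teval i e t = teval i e u
  | RelAtom p ts => irel i (fun k => teval i e (ts k))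
  end.

Fixpoint fo_holds (S : signature) (D : Type) (i : interp S D) (e : nat -> D)
    (phi : fo_formula S) : Prop :=
  match phi with
  | FoAtom a => fo_atom_holds i e a
  | FoFalse => False
  | FoImp phi psi => fo_holds i e phi -> fo_holds i e psi
  | FoAll x phi => forall d : D,
      fo_holds i (fun y => if y == x then d else e y) phi
  end.

(* A theory is a set of axioms; an axiom with free variables stands for its
   universal closure. *)
Definition theory (S : signature) := set (fo_formula S).

Definition is_model (S : signature) (T : theory S) (M : structure S) : Prop :=
  forall phi, T phi -> forall e : nat -> M, fo_holds (itp M) e phi.

Record is_embedding (S : signature) (M N : structure S) (h : M -> N) : Prop :=
  IsEmbedding {
    emb_inj : injective h;
    emb_fun : forall (f : fsym S) (xs : 'I_(far f) -> M),
      h (ifun (itp M) xs) = ifun (itp N) (fun k => h (xs k));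
    emb_rel : forall (p : psym S) (xs : 'I_(par p) -> M),
      irel (itp M) xs <-> irel (itp N) (fun k => h (xs k)) }.

(* The joint embedding property. It is what makes "sharing no variables or
   uninterpreted symbols" imply independence: over an arbitrary T, two
   satisfiable conjunctions with disjoint variables may be jointly unsatisfiable
   (take the single axiom (forall x, p x) \/ (forall x, ~ p x) and the literals
   p x and ~ p y). Complete theories have this property, and so has the empty
   theory over the empty signature (equality with uninterpreted symbols). *)
Definition joint_embedding (S : signature) (T : theory S) : Prop :=
  forall M N : structure S, is_model T M -> is_model T N ->
  exists K : structure S, is_model T K /\
    (exists h : M -> K, is_embedding h) /\ (exists h : N -> K, is_embedding h).

Inductive atom (S G : signature) :=
| BoolAtom of nat
| TAtom of fo_atom (sig_sum S G).

HB.instance Definition _ (S G : signature) := gen_eqMixin (atom S G).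
HB.instance Definition _ (S G : signature) := gen_choiceMixin (atom S G).

Inductive symbol (G : signature) :=
| VarSym of nat
| FunSym of fsym G
| RelSym of psym G
| BoolSym of nat.
Arguments VarSym {G}.
Arguments BoolSym {G}.

Fixpoint term_symbols (S G : signature) (t : term (sig_sum S G)) :
    set (symbol G) :=
  match t with
  | Var x => [set VarSym x]
  | App f ts =>
      (match f with inl _ => set0 | inr g => [set FunSym g] end)
      `|` [set s | exists k, term_symbols (ts k) s]
  end.

Definition atom_symbols (S G : signature) (a : atom S G) : set (symbol G) :=
  match a with
  | BoolAtom n => [set BoolSym n]
  | TAtom (EqAtom t u) => term_symbols t `|` term_symbols u
  | TAtom (RelAtom p ts) =>
      (match p with inl _ => set0 | inr q => [set RelSym q] end)
      `|` [set s | exists k, term_symbols (ts k) s]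
  end.

Definition no_shared_symbols (S G : signature) (al1 al2 : {fset atom S G}) :=
  forall a b, a \in al1 -> b \in al2 ->
    atom_symbols a `&` atom_symbols b = set0.

Inductive formula (S G : signature) :=
| Atom of atom S G
| FTrue
| FFalse
| FNot of formula S G
| FAnd of formula S G & formula S G
| FOr of formula S G & formula S G
| FImp of formula S G & formula S G
| FIff of formula S G & formula S G.
Arguments FTrue {S G}.
Arguments FFalse {S G}.

Fixpoint atoms (S G : signature) (phi : formula S G) : seq (atom S G) :=
  match phi with
  | Atom a => [:: a]
  | FTrue | FFalse => [::]
  | FNot phi => atoms phi
  | FAnd phi psi | FOr phi psi | FImp phi psi | FIff phi psi =>
      atoms phi ++ atoms psi
  end.

Fixpoint feval (S G : signature) (v : atom S G -> Prop) (phi : formula S G) :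
    Prop :=
  match phi with
  | Atom a => v a
  | FTrue => True
  | FFalse => False
  | FNot phi => ~ feval v phi
  | FAnd phi psi => feval v phi /\ feval v psi
  | FOr phi psi => feval v phi \/ feval v psi
  | FImp phi psi => feval v phi -> feval v psi
  | FIff phi psi => feval v phi <-> feval v psi
  end.

(* (a, true) is the literal a and (a, false) is the literal ~ a. Conjunctions
   of literals and clauses are both given by their finite set of literals. *)
Notation literal S G := (atom S G * bool)%type.
Notation literals S G := {fset literal S G}.

Definition lit_formula (S G : signature) (l : literal S G) : formula S G :=
  if l.2 then Atom l.1 else FNot (Atom l.1).

Definition conj_formula (S G : signature) (eta : literals S G) : formula S G :=
  foldr (fun l phi => FAnd (lit_formula l) phi) FTrue (enum_fset eta).

Definition clause_formula (S G : signature) (C : literals S G) : formula S G :=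
  foldr (fun l phi => FOr (lit_formula l) phi) FFalse (enum_fset C).

(* The clause ~ eta. *)
Definition neg_conj (S G : signature) (eta : literals S G) : literals S G :=
  [fset (l.1, ~~ l.2) | l in eta]%fset.

(* phi /\ the conjunction of all clauses of Cl. *)
Definition add_clauses (S G : signature) (phi : formula S G)
    (Cl : {fset literals S G}) : formula S G :=
  FAnd phi (foldr (fun C psi => FAnd (clause_formula C) psi) FTrue
                  (enum_fset Cl)).

(* The Boolean abstraction uses the atoms themselves as propositional
   variables, so that a valuation of the abstraction is any map from atoms to
   bool. *)
Definition prop_entails (S G : signature) (phi psi : formula S G) : Prop :=
  forall v : atom S G -> bool, feval v phi -> feval v psi.

Record t_interp (S G : signature) := TInterp {
  ti_struct : structure S;
  ti_uf : interp G ti_struct;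
  ti_env : nat -> ti_struct;
  ti_bool : nat -> bool }.

Definition atom_holds (S G : signature) (I : t_interp S G) (a : atom S G) :
    Prop :=
  match a with
  | BoolAtom n => ti_bool I n
  | TAtom b =>
      fo_atom_holds (interp_sum (itp (ti_struct I)) (ti_uf I)) (ti_env I) b
  end.

Definition t_sat (S G : signature) (T : theory S) (phi : formula S G) : Prop :=
  exists I : t_interp S G,
    is_model T (ti_struct I) /\ feval (atom_holds I) phi.

Definition t_valid (S G : signature) (T : theory S) (phi : formula S G) :
    Prop :=
  forall I : t_interp S G,
    is_model T (ti_struct I) -> feval (atom_holds I) phi.

Definition t_lemma (S G : signature) (T : theory S) (C : literals S G) : Prop :=
  t_valid T (clause_formula C).

Definition total_assignment (S G : signature) (al : {fset atom S G})
    (eta : literals S G) : Prop :=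
  (forall l, l \in eta -> l.1 \in al) /\
  (forall a, a \in al -> exists! b : bool, (a, b) \in eta).

Definition Hset (S G : signature) (T : theory S) (al : {fset atom S G})
    (psi : formula S G) : set (literals S G) :=
  [set eta | [/\ total_assignment al eta, prop_entails (conj_formula eta) psi
               & t_sat T (conj_formula eta)]].

Definition Pset (S G : signature) (T : theory S) (al : {fset atom S G})
    (psi : formula S G) : set (literals S G) :=
  [set rho | [/\ total_assignment al rho, prop_entails (conj_formula rho) psi
               & ~ t_sat T (conj_formula rho)]].

Definition rules_out (S G : signature) (Cs rhos : set (literals S G)) : Prop :=
  forall rho, rhos rho ->
  exists2 C, Cs C & prop_entails (conj_formula rho) (FNot (clause_formula C)).

Definition blocking1 (S G : signature) (T : theory S)
    (al1 al2 : {fset atom S G}) (psi : formula S G) : set (literals S G) :=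
  [set C | exists eta1 eta2,
    [/\ total_assignment al1 eta1, total_assignment al2 eta2,
        Hset T (al1 `|` al2)%fset psi (eta1 `|` eta2)%fset
      & C = neg_conj eta1]].

Definition blocking2 (S G : signature) (T : theory S)
    (al1 al2 : {fset atom S G}) (psi : formula S G) : set (literals S G) :=
  [set C | exists eta1 eta2,
    [/\ total_assignment al1 eta1, total_assignment al2 eta2,
        Hset T (al1 `|` al2)%fset psi (eta1 `|` eta2)%fset
      & C = neg_conj eta2]].

(* Main.v *)
(** A total assignment [rho] of [Pset T al phi] that is ruled out neither by
    [Cl] nor by [Cl'] satisfies every clause of [Cl], hence lies in both
    [Pset T al phi] and [Pset T al (add_clauses phi Cl)]. It is thus ruled out
    by some [~ eta1] and by some [~ eta2], i.e. [rho] is the union of two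
    conjunctions which are [T]-satisfiable separately. Both models embed into a
    common model of [T], and as no symbol is shared, the two interpretations of
    the variables and uninterpreted symbols can be transported there together:
    [rho] is [T]-satisfiable, a contradiction. *)
Require Import Defs.
From mathcomp Require Import all_boot finmap.
From mathcomp Require Import boolp classical_sets.

Local Open Scope classical_set_scope.

Section Propositional.
Context {S G : signature}.
Implicit Types (v : atom S G -> Prop) (l : literal S G) (eta C : literals S G).

Lemma feval_conj v eta :
  feval v (conj_formula eta) <->
  (forall l, l \in eta -> feval v (lit_formula l)).
Proof.
rewrite /conj_formula; split=> [+ l|].
  rewrite -[l \in eta]/(l \in enum_fset eta).
  elim: (enum_fset eta) => //= k s IHs [hk hs]; rewrite inE.
  by case/orP=> [/eqP ->|/IHs]; last exact.
move=> h; have {h}: forall l, l \in enum_fset eta -> feval v (lit_formula l).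
  by move=> l hl; apply: h.
elim: (enum_fset eta) => //= k s IHs h; split; first by apply: h; rewrite mem_head.
by apply: IHs => l ls; apply: h; rewrite inE ls orbT.
Qed.

Lemma feval_clause v C :
  feval v (clause_formula C) <->
  (exists2 l, l \in C & feval v (lit_formula l)).
Proof.
rewrite /clause_formula.
have -> : (exists2 l, l \in C & feval v (lit_formula l)) =
          (exists2 l, l \in enum_fset C & feval v (lit_formula l)) by [].
elim: (enum_fset C) => [|k s IHs] /=; first by split=> // -[].
split=> [[hk|/IHs [l ls hl]]|[l]].
- by exists k => //; rewrite mem_head.
- by exists l => //; rewrite inE ls orbT.
- rewrite inE => /orP[/eqP ->|ls hl]; [by left|right].
  by apply/IHs; exists l.
Qed.

Lemma feval_add_clauses v (phi : formula S G) (Cl : {fset literals S G}) :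
  feval v phi -> (forall C, C \in Cl -> feval v (clause_formula C)) ->
  feval v (add_clauses phi Cl).
Proof.
rewrite /add_clauses /= => hphi h; split=> //.
have {h}: forall C, C \in enum_fset Cl -> feval v (clause_formula C).
  by move=> C hC; apply: h.
elim: (enum_fset Cl) => //= C s IHs h; split; first by apply: h; rewrite mem_head.
by apply: IHs => D Ds; apply: h; rewrite inE Ds orbT.
Qed.

Lemma feval_neg_conj v eta :
  ~ feval v (clause_formula (neg_conj eta)) -> feval v (conj_formula eta).
Proof.
move=> nv; apply/feval_conj => -[a b] hl; apply: contrapT => nl; apply: nv.
apply/feval_clause; exists (a, ~~ b); first by apply/imfsetP; exists (a, b).
by case: b {hl} nl => //= /contrapT.
Qed.

Lemma feval_lit_true (v : atom S G -> bool) l :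
  feval v (lit_formula l) <-> v l.1 = l.2.
Proof.
case: l => a [] //=; rewrite /lit_formula /=.
by split=> [/negP/negbTE|->].
Qed.

(** Exactly one of the two literals on an atom of [al] lies in [eta], so membership of the positive
    one settles both signs. *)
Lemma total_literal {al : {fset atom S G}} {eta} : total_assignment al eta ->
  forall l, l.1 \in al -> ((l.1, true) \in eta) = l.2 <-> l \in eta.
Proof.
move=> [_ tot] [a b] /= /tot [c [hc uc]].
case: b; first by [].
split; last by move=> /uc hb; apply/negP => /uc; rewrite hb.
by case: c hc {uc} => // ->.
Qed.

(* The valuation [v a = ((a, true) \in eta)] is the only one, on [al], that
   satisfies [eta]. *)
Lemma total_conj {al : {fset atom S G}} {eta} : total_assignment al eta ->
  feval (fun a => (a, true) \in eta) (conj_formula eta).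
Proof.
move=> tot; apply/feval_conj => l hl.
by apply/feval_lit_true/(total_literal tot) => //; apply: tot.1.
Qed.

(** All valuations satisfying [eta] agree on [al], hence on [C], so one that falsifies [C] forces
    all of them to falsify it. *)
Lemma total_entails_clause {al : {fset atom S G}} {eta C} :
  total_assignment al eta -> (forall l, l \in C -> l.1 \in al) ->
  ~ prop_entails (conj_formula eta) (FNot (clause_formula C)) ->
  prop_entails (conj_formula eta) (clause_formula C).
Proof.
move=> tot Cal nent v veta; apply: contrapT => nC; apply: nent => w weta /=.
move=> /feval_clause [l lC wl]; apply: nC; apply/feval_clause; exists l => //.
have [_ /(_ _ (Cal _ lC)) [b [hb _]]] := tot.
move/feval_conj/(_ _ hb)/feval_lit_true: veta => /= vb.
move/feval_conj/(_ _ hb)/feval_lit_true: weta => /= wb.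
by apply/feval_lit_true; rewrite vb -wb; apply/feval_lit_true.
Qed.

(** The valuation read off [rho] falsifies the clause, so it satisfies [eta]. By totality [eta] has
    a literal on each atom of [al'], and its sign must then be the one chosen by [rho]. *)
Lemma entails_neg_conj {al al' : {fset atom S G}} {rho eta} :
  total_assignment al rho -> total_assignment al' eta ->
  prop_entails (conj_formula rho) (FNot (clause_formula (neg_conj eta))) ->
  forall l, l \in rho -> l.1 \in al' -> l \in eta.
Proof.
move=> totr tote ent [a b] lr /(proj2 tote) [c [hc _]].
have := ent _ (total_conj totr) => /feval_neg_conj/feval_conj/(_ _ hc).
move=> /feval_lit_true /= cE.
have al_a : (a, b).1 \in al by exact: totr.1 lr.
by have /= bE := (total_literal totr _ al_a).2 lr; rewrite -bE cE.
Qed.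

End Propositional.

Section Amalgamation.
Context {S G : signature}.

(** Compatibility is stated one symbol at a time, so that two embeddings into the same structure can
    each answer for their own share of the symbols. *)
Definition transports {I J : t_interp S G} (h : ti_struct I -> ti_struct J)
    (s : symbol G) : Prop :=
  match s with
  | VarSym x => h (ti_env I x) = ti_env J x
  | FunSym g => forall xs,
      h (ifun (ti_uf I) (f := g) xs) = ifun (ti_uf J) (h \o xs)
  | RelSym q => forall xs,
      irel (ti_uf I) (p := q) xs <-> irel (ti_uf J) (h \o xs)
  | BoolSym n => ti_bool I n = ti_bool J n
  end.

Lemma teval_transport {I J : t_interp S G} (h : ti_struct I -> ti_struct J) :
  is_embedding h -> forall t : term (sig_sum S G),
  (forall s, term_symbols t s -> transports h s) ->
  h (teval (interp_sum (itp (ti_struct I)) (ti_uf I)) (ti_env I) t) =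
  teval (interp_sum (itp (ti_struct J)) (ti_uf J)) (ti_env J) t.
Proof.
move=> emb; elim=> [x|f ts IHts] /= tr; first exact: (tr (VarSym x)).
have /funext argsE k := IHts k (fun s hs => tr s (or_intror (ex_intro _ k hs))).
case: f ts tr argsE {IHts} => f ts tr /= <-; first exact: emb_fun.
by have /(_ (or_introl erefl)) /= -> := tr (FunSym f).
Qed.

(** An equivalence is needed because negative literals are transported too; for equalities the
    converse is the injectivity of [h]. *)
Lemma atom_holds_transport {I J : t_interp S G}
    (h : ti_struct I -> ti_struct J) : is_embedding h -> forall a : atom S G,
  (forall s, atom_symbols a s -> transports h s) ->
  atom_holds I a <-> atom_holds J a.
Proof.
move=> emb [n|[t u|p ts]] /= tr; first by have /= -> := tr (BoolSym n) erefl.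
  rewrite -!(teval_transport h emb); first last.
  - by move=> s hs; apply: tr; left.
  - by move=> s hs; apply: tr; right.
  by split=> [->|/(emb_inj emb)].
have /funext argsE k := teval_transport h emb (ts k)
  (fun s hs => tr s (or_intror (ex_intro _ k hs))).
case: p ts tr argsE => p ts tr /= <-; first exact: emb_rel.
exact: (tr (RelSym p) (or_introl erefl)).
Qed.

Lemma embedding_left_inverse {M N : structure S} (h : M -> N) :
  is_embedding h -> exists g : N -> M, cancel h g.
Proof.
move=> emb; suff /choice [g hg] : forall y, exists x, forall z, h z = y -> x = z.
  by exists g => x; apply: hg.
move=> y; have [[x <-]|ny] := pselect (exists x, h x = y).
  by exists x => z /(emb_inj emb).
(* Outside the image of [h] any value will do; the carrier is nonempty. *)
by exists (dom_pt M) => z hz; case: ny; exists z.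
Qed.

(* Functions and relations are moved along an embedding [h] by precomposition
   with a left inverse of [h]; their values outside the image do not matter. *)
Lemma amalgamation (I1 I2 : t_interp S G) (K : structure S)
    (h1 : ti_struct I1 -> K) (h2 : ti_struct I2 -> K) (X : set (symbol G)) :
  is_embedding h1 -> is_embedding h2 ->
  exists uf env bl, let J := @TInterp S G K uf env bl in
    (forall s, X s -> @transports I1 J h1 s) /\
    (forall s, ~ X s -> @transports I2 J h2 s).
Proof.
move=> /embedding_left_inverse [g1 hK1] /embedding_left_inverse [g2 hK2].
have cancel_comp (A B : Type) (h : A -> B) g n (xs : 'I_n -> A) :
    cancel h g -> g \o (h \o xs) = xs.
  by move=> hK; apply/funext => k /=; rewrite hK.
exists (@Interp G K
  (fun f ys => if `[< X (FunSym f) >] then h1 (ifun (ti_uf I1) (g1 \o ys))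
               else h2 (ifun (ti_uf I2) (g2 \o ys)))
  (fun p ys => if `[< X (RelSym p) >] then irel (ti_uf I1) (g1 \o ys)
               else irel (ti_uf I2) (g2 \o ys))).
exists (fun x => if `[< X (VarSym x) >] then h1 (ti_env I1 x)
                 else h2 (ti_env I2 x)).
exists (fun n => if `[< X (BoolSym n) >] then ti_bool I1 n else ti_bool I2 n).
split=> -[x|f|p|n] Xs /=; try move=> xs.
(* Membership in [X] selects the branch, and the left inverse undoes the embedding on the
   arguments. *)
all: by rewrite ?(asboolT Xs) ?(asboolF Xs) ?cancel_comp.
Qed.

End Amalgamation.

Lemma disjoint_t_sat (S G : signature) (T : theory S) (al1 al2 : {fset atom S G})
    (eta1 eta2 rho : literals S G) :
  joint_embedding T -> no_shared_symbols al1 al2 ->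
  t_sat T (conj_formula eta1) -> t_sat T (conj_formula eta2) ->
  (forall l, l \in rho -> l.1 \in al1 /\ l \in eta1 \/ l.1 \in al2 /\ l \in eta2) ->
  t_sat T (conj_formula rho).
Proof.
move=> hT disj [I1 [M1 /feval_conj s1]] [I2 [M2 /feval_conj s2]] rhoE.
have [K [MK [[h1 e1] [h2 e2]]]] := hT _ _ M1 M2.
(* Symbols of [al1] are read in [I1] and all others in [I2]; by disjointness the latter include
   every symbol of [al2]. *)
pose X : set (symbol G) := [set s | exists2 a, a \in al1 & atom_symbols a s].
have [uf [env [bl [tr1 tr2]]]] := amalgamation I1 I2 K h1 h2 X e1 e2.
pose J := @TInterp S G K uf env bl.
exists J; split=> //.
apply/feval_conj => -[a b] /rhoE /= [[aal /s1]|[aal /s2]].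
  have [f g] : atom_holds I1 a <-> atom_holds J a.
    apply: (@atom_holds_transport _ _ I1 J h1 e1) => s hs.
    by apply: tr1; exists a.
  by case: b => //= nI; apply: contra_not nI.
have [f g] : atom_holds I2 a <-> atom_holds J a.
  apply: (@atom_holds_transport _ _ I2 J h2 e2) => s hs.
  apply: tr2 => -[c cal hc]; have : set0 s by rewrite -(disj c a).
  by [].
by case: b => //= nI; apply: contra_not nI.
Qed.

Lemma t_sat_subset (S G : signature) (T : theory S) (eta rho : literals S G) :
  (forall l, l \in eta -> l \in rho) ->
  t_sat T (conj_formula rho) -> t_sat T (conj_formula eta).
Proof.
move=> sub [I [MI /feval_conj sI]]; exists I; split=> //.
by apply/feval_conj => l /sub/sI.
Qed.

Theorem theorem2 (S G : signature) (T : theory S) (hT : joint_embedding T)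
  (phi : formula S G) (al al1 al2 : {fset atom S G})
  (hal : al = (al1 `|` al2)%fset)
  (hphi : forall a, a \in atoms phi -> a \in al)
  (hdisj : no_shared_symbols al1 al2)
  (Cl : {fset literals S G})
  (hCl : forall C, C \in Cl -> t_lemma T C)
  (hCl_al : forall C l, C \in Cl -> l \in C -> l.1 \in al)
  (hout1 : rules_out (blocking1 T al1 al2 phi `|` [set C | C \in Cl])
                     (Pset T al phi))
  (Cl' : {fset literals S G})
  (hCl' : forall C, C \in Cl' -> t_lemma T C)
  (hout2 : rules_out
             (blocking2 T al1 al2 (add_clauses phi Cl) `|` [set C | C \in Cl'])
             (Pset T al (add_clauses phi Cl))) :
  rules_out [set C | C \in (Cl `|` Cl')%fset] (Pset T al phi).
Proof.
move=> rho rhoP; have [tot ent nsat] := rhoP.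
apply: contrapT => nout.
(* A clause of [Cl] that does not rule out [rho] is entailed by it, since its atoms lie in [al]. *)
have entCl C : C \in Cl -> prop_entails (conj_formula rho) (clause_formula C).
  move=> CCl; apply: (total_entails_clause tot); first by move=> l; apply: hCl_al.
  by move=> entN; apply: nout; exists C => //=; rewrite in_fsetU CCl.
have rhoP' : Pset T al (add_clauses phi Cl) rho.
  split=> // v vrho; apply: feval_add_clauses; first exact: ent.
  by move=> C CCl; apply: entCl.
have [C1 [[eta1 [eta2' [tot1 _ [_ _ sat1] ->]]]|CCl] out1] := hout1 _ rhoP; last first.
  by apply: nout; exists C1 => //=; rewrite in_fsetU CCl.
(* This pair is in general not the one found before: only [eta1] of the first and [eta2] of the
   second are kept, each satisfiable as part of a satisfiable conjunction. *)
have [C2 [[eta1' [eta2 [_ tot2 [_ _ sat2] ->]]]|CCl] out2] := hout2 _ rhoP'; last first.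
  by apply: nout; exists C2 => //=; rewrite in_fsetU CCl orbT.
apply: nsat; apply: (@disjoint_t_sat _ _ _ al1 al2 eta1 eta2) => //.
- by apply: t_sat_subset sat1 => l leta; rewrite in_fsetU leta.
- by apply: t_sat_subset sat2 => l leta; rewrite in_fsetU leta orbT.
- move=> l lrho; have := tot.1 _ lrho; rewrite hal in_fsetU => /orP[] lal.
    by left; split=> //; apply: (entails_neg_conj tot tot1 out1).
  by right; split=> //; apply: (entails_neg_conj tot tot2 out2).
Qed.
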